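(* Let $s\ge 2$ and let $\mathcal{J}\subset\mathbb{R}^2$ be the self-similar set (the unique non-empty compact set) satisfying $\mathcal{J}=\bigcup_{i=1}^s T_i(\mathcal{J})$, where $T_i(x)=\frac1s x+z_i$ with $z_1,\dots,z_s\in\mathbb{R}^2$ (no rotations, equal contraction ratios, similarity dimension $1$), and assume that $\mathcal{J}$ satisfies the Open Set Condition. Let $\mathcal{J}_0$ be the convex hull of $\mathcal{J}$ and $\mathcal{J}_{n+1}=\bigcup_{i=1}^s T_i(\mathcal{J}_n)$ for $n\ge 0$. Then for every $a\in\mathbb{R}^2\setminus\mathcal{J}$ there are constants $C_1,C_2>0$, depending on $a$ and $\mathcal{J}$, such that for all integers $n\geq 1$, $$\operatorname{vis}(a;\mathcal{J}_n)\le C_1\sqrt{\operatorname{Fav}\big(\mathcal{J}_{C_2\log n}\big)},$$ where the index $C_2\log n$ is understood as its integer part. Moreover, if $\mathcal{J}$ is given and $a$ ranges over a fixed compact set disjoint from $\mathcal{J}$, then the constants $C_1,C_2$ may be chosen uniform for all such $a$.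
   Context: For $a\in\mathbb{R}^2$ the radial projection is $P_a:\mathbb{R}^2\setminus\{a\}\to\mathbb{S}^1$, $P_a(x)=\frac{x-a}{|x-a|}$. The visibility of a set $S$ from $a$ is $\operatorname{vis}(a;S)=\frac1{2\pi}|P_a(S\setminus\{a\})|$, where $|\cdot|$ is the arc-length measure on the circle. The linear projection is $\pi_\theta(x,y)=x\cos\theta+y\sin\theta$, and the Favard length is $\operatorname{Fav}(S)=\frac1\pi\int_0^\pi|\pi_\theta(S)|\,d\theta$, with $|\cdot|$ the Lebesgue measure on $\mathbb{R}$. The Open Set Condition: there exists a (non-empty) open set $O\subset\mathbb{R}^2$ such that $\bigcup_{i=1}^sT_i(O)\subset O$ and the sets $T_i(O)$ are pairwise disjoint. *)

(* Defs.v *)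
From mathcomp Require Import all_boot all_order all_algebra.
From mathcomp Require Import all_classical all_reals all_analysis.
Set Implicit Arguments.
Unset Strict Implicit.
Unset Printing Implicit Defensive.
Import Order.TTheory GRing.Theory Num.Theory.
Import numFieldNormedType.Exports.
Local Open Scope classical_set_scope.
Local Open Scope ring_scope.

(* The product carries the usual topology of the plane, but its library norm
   is the max norm, so the Euclidean norm is defined separately. *)
Definition plane (R : realType) := (R^o * R^o)%type.

Definition enorm (R : realType) (x : plane R) : R :=
  Num.sqrt (x.1 ^+ 2 + x.2 ^+ 2).

Definition radial_proj (R : realType) (a x : plane R) : plane R :=
  (enorm (x - a))^-1 *: (x - a).

(* Arc length is the image of Lebesgue measure under t |-> (cos t, sin t),
   t in [0, 2 pi[; points of A off the unit circle do not contribute. *)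
Definition arc_length (R : realType) (A : set (plane R)) : \bar R :=
  lebesgue_measure
    [set t : R | 0 <= t < 2 * pi /\ A ((cos t, sin t) : plane R)].

Definition vis (R : realType) (a : plane R) (S : set (plane R)) : \bar R :=
  (((2 * pi)^-1)%:E * arc_length (radial_proj a @` (S `\ a)))%E.

Definition lin_proj (R : realType) (theta : R) (x : plane R) : R :=
  x.1 * cos theta + x.2 * sin theta.

Definition Fav (R : realType) (S : set (plane R)) : \bar R :=
  ((pi^-1)%:E * \int[lebesgue_measure]_(theta in `[0%R, pi])
                   lebesgue_measure (lin_proj theta @` S))%E.

Definition simil (R : realType) (s : nat) (z : 'I_s -> plane R) (i : 'I_s)
  (x : plane R) : plane R := (s%:R)^-1 *: x + z i.

Definition ifs_step (R : realType) (s : nat) (z : 'I_s -> plane R)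
  (S : set (plane R)) : set (plane R) := \bigcup_i (simil z i @` S).

Definition self_similar_set (R : realType) (s : nat) (z : 'I_s -> plane R)
  (J : set (plane R)) : Prop :=
  [/\ J !=set0, compact J & J = ifs_step z J].

Definition open_set_condition (R : realType) (s : nat) (z : 'I_s -> plane R) :
  Prop :=
  exists O : set (plane R),
    [/\ O !=set0, open O, ifs_step z O `<=` O &
        trivIset setT (fun i : 'I_s => simil z i @` O)].

Definition convex_hull (R : realType) (S : set (plane R)) : set (plane R) :=
  smallest (@convex_set R (plane R)) S.

Definition ifs_approx (R : realType) (s : nat) (z : 'I_s -> plane R)
  (J : set (plane R)) (n : nat) : set (plane R) :=
  iter n (ifs_step z) (convex_hull J).

(* Main.v *)
(* We show vis(a; J_n) <= C sqrt(Fav J_k) as soon as n >= 2 k + m0, with m0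
   depending only on J and the distance from a to J; this is much more than needed.

   Seen from a, a piece s^-m J_k + v with m >= k has angular size O(s^-m), so the
   radial projection differs on it from the linear projection orthogonal to the
   line of sight by O(s^-2m), which is O(s^-(m+k)), the size of the smallest
   cells.  Its angular measure is thus O(s^-m |pi_theta J_k|), where theta is
   orthogonal to any direction in which the piece is seen.  Put h = c s^-k and call
   theta rich if pi_theta J_k contains M disjoint intervals of length h with M h
   about sqrt(Fav J_k).  By Chebyshev's inequality the rich directions have measure
   O(sqrt(Fav J_k)).  A piece seen in some direction whose orthogonal is not rich
   has angular measure O(s^-m M h) apart from its rich directions, and there are
   s^m pieces.

   This requires pi_theta J_0 to have length at least c for every theta, i.e. J
   not contained in a line.  If J lies on a line, the open set condition bounds
   Fav J_k from below. *)
Require Import Defs.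
From mathcomp Require Import all_boot all_order all_algebra.
From mathcomp Require Import all_classical all_reals all_analysis.
From mathcomp Require Import measurable_realfun zify ring lra.
Import Order.TTheory GRing.Theory Num.Theory.
Import numFieldNormedType.Exports.
Local Open Scope classical_set_scope.
Local Open Scope ring_scope.
Set Implicit Arguments.
Unset Strict Implicit.
Unset Printing Implicit Defensive.

(** * Lebesgue outer measure *)

Section Measure.
Context {R : realType}.
Implicit Types (A B : set R).
Local Notation mu := (@lebesgue_measure R).

(** [lebesgue_measure] unfolds to an outer measure on all subsets of the line. This matters for sets
    of directions seen from a point, whose measurability is never established. *)
Lemma le_lebesgue A B : A `<=` B -> (mu A <= mu B)%E.
Proof.
rewrite /lebesgue_measure /lebesgue_stieltjes_measure /measure_extension => AB.
exact: le_mu_ext.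
Qed.

(** Finite subadditivity of the outer measure, peeling off one set of the cover at a time. *)
Lemma lebesgue_cover (I : eqType) (s : seq I) (F : I -> set R) (c : R) A :
  (forall x, A x -> exists2 i, i \in s & F i x) ->
  (forall i, i \in s -> (mu (F i) <= c%:E)%E) ->
  (mu A <= ((size s)%:R * c)%:E)%E.
Proof.
elim: s A => [|i s IH] A As Fc.
  rewrite mul0r; apply: (@le_trans _ _ (mu set0)); last by rewrite measure0.
  by apply: le_lebesgue => x /As[].
have : (mu A <= mu (F i) + mu (A `\` F i))%E.
  apply: (@le_trans _ _ (mu (F i `|` (A `\` F i)))).
    by apply: le_lebesgue => x Ax; case: (pselect (F i x)); [left|right].
  rewrite /lebesgue_measure /lebesgue_stieltjes_measure /measure_extension.
  exact: outer_measureU2.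
move=> /le_trans; apply.
rewrite -[size _]/((size s).+1) -nat1r mulrDl mul1r EFinD leeD//.
  by apply: Fc; rewrite mem_head.
apply: IH => [x [Ax nF]|j js]; last by apply: Fc; rewrite in_cons js orbT.
have [j] := As _ Ax; rewrite in_cons => /orP[/eqP->//|js Fj]; by exists j.
Qed.

(** The pushforward under a translation agrees with Lebesgue measure on half-open intervals, hence
    equals it by uniqueness. *)
Lemma lebesgue_translate (c : R) A : measurable A ->
  mu [set x | A (x + c)] = mu A.
Proof.
move=> mA; pose f : R -> measurableTypeR R := +%R^~ c.
have mf : measurable_fun setT f by exact: measurable_funD.
suff -> : mu A = pushforward mu f A by [].
apply: lebesgue_measure_unique => // _ [[a b]] _ <-.
transitivity (mu `]a - c, b - c]%classic); last first.
  congr (mu _); apply/seteqP; split => x /=;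
    by rewrite !in_itv/= /f ltrBlDr lerBrDr.
rewrite !lebesgue_measure_itv/= !lte_fin ltrD2r.
by rewrite -!EFinB (_ : b - c - (a - c) = b - a)//; ring.
Qed.

End Measure.

Section IntegralLowerBound.
Import HBNNSimple.

(* [f] is not assumed measurable: the integral of a nonnegative function is the
   supremum over the simple functions below it. *)
Lemma integral_ge_indic d (T : measurableType d) (R : realType)
    (mu : {measure set T -> \bar R}) (D E : set T) (f : T -> \bar R) (c : R) :
  0 <= c -> measurable E -> E `<=` D ->
  (forall x, D x -> (0 <= f x)%E) -> (forall x, E x -> (c%:E <= f x)%E) ->
  (c%:E * mu E <= \int[mu]_(x in D) f x)%E.
Proof.
move=> c0 mE ED f0 fc; rewrite ge0_integralE//.
pose h := scale_nnsfun (indic_nnsfun R mE) c0.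
have -> : (c%:E * mu E)%E = sintegral mu h.
  have := @integral_nnsfun _ _ R mu setT measurableT h.
  rewrite patch_setT => <-.
  under eq_integral do rewrite /= EFinM.
  rewrite ge0_integralZl_EFin//.
  - by rewrite (integral_indic mu measurableT mE) setIT.
  - by move=> x _; rewrite lee_fin mindicE ler0n.
  - by apply/measurable_EFinP; exact: measurable_indic.
apply: ereal_sup_ubound; exists h => //= x; rewrite /patch mindicE.
case: ifPn; rewrite ?inE ?notin_setE => Dx;
  case: (boolP (x \in E)); rewrite ?inE ?notin_setE => Ex /=.
- by rewrite mulr1; exact: fc.
- by rewrite mulr0; exact: f0.
- by have := Dx (ED _ Ex).
- by rewrite mulr0.
Qed.

End IntegralLowerBound.
(** * Measure of sets of angles *)

Section Angles.
Context {R : realType}.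
Implicit Types (x y eta : R).
Local Notation mu := (@lebesgue_measure R).

(** By the mean value theorem [sin x = x * cos c] with [c] between [0] and [x], and there [cos c] is
    at least [cos x]. *)
Lemma half_le_sin x : 0 <= x <= pi / 2 -> 2^-1 <= cos x -> x / 2 <= sin x.
Proof.
move=> /andP[x0 xp] cx; have [->|xn0] := eqVneq x 0; first by rewrite sin0 mul0r.
have {}x0 : 0 < x by rewrite lt_neqAle eq_sym xn0.
have pi0 := pi_gt0 R.
have [c] := @MVT R sin cos 0 x x0 (fun y _ => is_derive_sin y)
  (continuous_subspaceT (@continuous_sin R)).
rewrite in_itv/= => /andP[c0 cx']; rewrite sin0 !subr0 => ->.
rewrite mulrC ler_wpM2r ?(ltW x0)//; apply: (le_trans cx).
by rewrite ltW// ltr_cos// in_itv/=; apply/andP; split; lra.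
Qed.

Lemma near_multiple_2pi x eta : `|x| < 2 * pi -> 2^-1 <= cos x ->
  `|sin x| <= eta -> `|x| <= 2 * eta \/ 2 * pi - `|x| <= 2 * eta.
Proof.
have pi0 := pi_gt0 R.
have -> : `|sin x| = `|sin `|x| | by case: (ger0P x) => // _; rewrite sinN normrN.
rewrite -cos_norm; move: `|x| (normr_ge0 x) => {}x x0 x2 cx sx.
have [xp|xp] := leP x (pi / 2).
  left; have := half_le_sin (introT andP (conj x0 xp)) cx.
  by have := ler_norm (sin x); lra.
(* In the middle range the cosine is nonpositive, against the hypothesis; beyond it, reflection at
   [2 * pi] leads back to the first quadrant. *)
have [xq|xq] := ltP x (3 * (pi / 2)).
  have : 0 <= cos (x - pi) by apply: cos_ge0_pihalf; apply/andP; split; lra.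
  by rewrite cosB cospi sinpi; lra.
right; have := @half_le_sin (2 * pi - x).
have -> : sin (2 * pi - x) = - sin x.
  by rewrite sinB mulr_natl sin2pi cos2pi; ring.
have -> : cos (2 * pi - x) = cos x.
  by rewrite cosB mulr_natl sin2pi cos2pi; ring.
move=> /(_ _ cx); have := ler_norm (- sin x); rewrite normrN => h h2.
by suff : (2 * pi - x) / 2 <= - sin x; [lra|apply: h2; apply/andP; split; lra].
Qed.

(** Fix one angle [u] of [A]. All others lie within [2 * eta] of [u], [u + 2 * pi] or [u - 2 * pi],
    that is, in three intervals of length [4 * eta]. *)
Lemma arc_measure_le (A : set R) eta : 0 <= eta ->
  (forall t, A t -> 0 <= t < 2 * pi) ->
  (forall t u, A t -> A u -> 2^-1 <= cos (t - u) /\ `|sin (t - u)| <= eta) ->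
  (mu A <= (12 * eta)%:E)%E.
Proof.
move=> eta0 A2 Aeta; have [[u Au]|nA] := pselect (A !=set0); last first.
  apply: (@le_trans _ _ (mu set0)); last by rewrite measure0 lee_fin mulr_ge0.
  by apply: le_lebesgue => t At; apply: nA; exists t.
have pi0 := pi_gt0 R.
pose F (c : R) := `[u + c - 2 * eta, u + c + 2 * eta]%classic.
rewrite (_ : 12 * eta =
  (size [:: 0; 2 * pi; - (2 * pi) : R])%:R * (4 * eta)); last first.
  by rewrite /=; ring.
apply: (@lebesgue_cover R _ _ F).
  move=> t At; have [c s] := Aeta t u At Au.
  have /andP[t0 t2] := A2 t At; have /andP[u0 u2] := A2 u Au.
  have tu : `|t - u| < 2 * pi by rewrite ltr_norml; apply/andP; split; lra.
  have [|] := near_multiple_2pi tu c s.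
    rewrite ler_norml => /andP[l r]; exists 0; first by rewrite !inE eqxx.
    by rewrite /F/= in_itv/=; apply/andP; split; lra.
  case: (ger0P (t - u)) => [tu0 h|tu0 h].
    exists (2 * pi); first by rewrite !inE eqxx orbT.
    by rewrite /F/= in_itv/=; apply/andP; split; lra.
  exists (- (2 * pi)); first by rewrite !inE eqxx !orbT.
  by rewrite /F/= in_itv/=; apply/andP; split; lra.
move=> c _; rewrite /F lebesgue_measure_itv/= lte_fin; case: ifP => // _.
  by rewrite -EFinB lee_fin; lra.
by rewrite lee_fin mulr_ge0.
Qed.

(** The rotated angle [t + pi / 2] runs through an interval that meets three consecutive periods of
    [E]; each contributes at most [c]. *)
Lemma perp_measure_le (E : set R) (c : R) : measurable E ->
  (forall x, E x <-> E (x + pi)) -> (mu (E `&` `[0%R, pi]) <= c%:E)%E ->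
  (mu [set t : R | (0 <= t < 2 * pi)%R /\ E (t + pi / 2)%R] <= (3 * c)%:E)%E.
Proof.
move=> mE Epi Ec; have pi0 := pi_gt0 R.
pose F (i : nat) := [set t : R | (E `&` `[0%R, pi]) (t + (pi / 2 - i%:R * pi))].
apply: (@lebesgue_cover R nat [:: 0; 1; 2]%N F).
  move=> t [/andP[t0 t2] Et].
  have E1 : E (t + pi / 2 - pi) by apply/Epi; rewrite subrK.
  have E2 : E (t + pi / 2 - pi - pi) by apply/Epi; rewrite subrK.
  have [h|h] := leP (t + pi / 2) pi.
    exists 0%N => //; split; first by rewrite mul0r subr0.
    by rewrite /= in_itv/=; apply/andP; split; lra.
  have [h1|h1] := leP (t + pi / 2) (2 * pi).
    exists 1%N => //; split; first by rewrite mul1r addrA.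
    by rewrite /= in_itv/=; apply/andP; split; lra.
  exists 2%N => //; split.
    by rewrite (_ : t + _ = t + pi / 2 - pi - pi)//; ring.
  by rewrite /= in_itv/=; apply/andP; split; lra.
move=> i _; rewrite lebesgue_translate//.
by apply: measurableI.
Qed.
End Angles.
(** * Iterated function systems *)

Section Plane.
Context {R : realType}.
Implicit Types (a t : R) (x y : plane R).

Lemma planeP x y : x.1 = y.1 -> x.2 = y.2 -> x = y.
Proof. by case: x y => [? ?] [? ?] /= -> ->. Qed.

Lemma fstZ a x : (a *: x).1 = a * x.1 :> R. Proof. by []. Qed.
Lemma sndZ a x : (a *: x).2 = a * x.2 :> R. Proof. by []. Qed.
Lemma fstD x y : (x + y).1 = x.1 + y.1 :> R. Proof. by []. Qed.
Lemma sndD x y : (x + y).2 = x.2 + y.2 :> R. Proof. by []. Qed.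
Lemma fstN x : (- x).1 = - x.1 :> R. Proof. by []. Qed.
Lemma sndN x : (- x).2 = - x.2 :> R. Proof. by []. Qed.
Definition coordE := (fstZ, sndZ, fstD, sndD, fstN, sndN).

Lemma conv_planeE (l : {i01 R}) (x y : convex_lmodType (plane R)) :
  conv l x y = l%:num *: (x : plane R) + (1 - l%:num) *: (y : plane R).
Proof. by []. Qed.
End Plane.

Section Words.
Context {R : realType} {s : nat} (z : 'I_s -> plane R).
Implicit Types (S : set (plane R)) (w : seq 'I_s).
Local Notation rho := ((s%:R : R)^-1).

(** The translation part of the composition of the similarities along [w], whose linear part is
    [rho ^+ size w]. *)
Fixpoint word_pt w : plane R :=
  if w is i :: w' then rho *: word_pt w' + z i else 0.

Lemma iter_ifs_stepP S k x : iter k (ifs_step z) S x <->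
  exists (w : k.-tuple 'I_s) (y : plane R), S y /\ x = rho ^+ k *: y + word_pt w.
Proof.
suff H : iter k (ifs_step z) S x <->
  exists w (y : plane R), [/\ size w = k, S y & x = rho ^+ k *: y + word_pt w].
  split=> [/H[w [y [/eqP sw Sy ->]]]|[w [y [Sy xE]]]]; first by exists (Tuple sw), y.
  by apply/H; exists w, y; rewrite size_tuple.
elim: k x => [|k IH] x /=.
  split=> [Sx|[w [y [/size0nil -> Sy ->]]]]; last by rewrite expr0 scale1r addr0.
  by exists [::], x; rewrite expr0 scale1r addr0.
split=> [[i _ [_ /IH[w [y [<- Sy ->]]] <-]]|[[|i w] [y []]]] //.
  exists (i :: w), y; split=> //=.
  by rewrite /simil scalerDr scalerA -exprS addrA.
move=> [sw] Sy ->; exists i => //; exists (rho ^+ k *: y + word_pt w).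
  by apply/IH; exists w, y.
by rewrite /simil scalerDr scalerA -exprS addrA.
Qed.

Lemma iter_ifs_step_mono k S S' : S `<=` S' ->
  iter k (ifs_step z) S `<=` iter k (ifs_step z) S'.
Proof.
move=> SS' x /iter_ifs_stepP[w [y [/SS' Sy ->]]].
by apply/iter_ifs_stepP; exists w, y.
Qed.

Lemma iter_ifs_step_dec S m n : ifs_step z S `<=` S -> (m <= n)%N ->
  iter n (ifs_step z) S `<=` iter m (ifs_step z) S.
Proof.
move=> zS mn; rewrite -(subnKC mn) iterD; apply: iter_ifs_step_mono.
elim: (n - m)%N => // k IH; apply: subset_trans zS.
exact: (iter_ifs_step_mono (k := 1) IH).
Qed.

(** The preimage under an affine map of a convex set containing [J] is convex, and it contains [J]
    by hypothesis. *)
Lemma convex_hull_ifs_step (J : set (plane R)) : ifs_step z J `<=` J ->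
  ifs_step z (convex_hull J) `<=` convex_hull J.
Proof.
move=> zJ _ [i _ [x Jx <-]] C [cC JC].
suff : (simil z i @^-1` C) x by [].
apply: Jx; split; last first.
  by move=> y Jy; apply: JC; apply: zJ; exists i => //; exists y.
move=> u v l; rewrite !inE => Cu Cv.
have := cC (simil z i u) (simil z i v) l; rewrite !inE => /(_ Cu Cv).
rewrite /preimage/=; congr (C _).
rewrite !conv_planeE /simil; apply: planeP; rewrite !coordE; ring.
Qed.

(** The open set contains a max-norm ball of radius [r] about [q]. If two word points of length [k]
    were closer than [r * rho ^+ k] in both coordinates, the corresponding copies of the open set
    would share a point. *)
Lemma osc_word_sep : open_set_condition z -> (0 < s)%N ->
  exists2 r : R, 0 < r & forall k (w w' : k.-tuple 'I_s), w != w' ->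
    r * rho ^+ k <= `|(word_pt w - word_pt w').1| \/
    r * rho ^+ k <= `|(word_pt w - word_pt w').2|.
Proof.
move=> [U [[q Uq] oU zU tU]] s0.
have T w : forall x : plane R, U x -> U (rho ^+ size w *: x + word_pt w).
  elim: w => [|i w IH] x Ux /=; first by rewrite expr0 scale1r addr0.
  apply: zU; exists i => //; exists (rho ^+ size w *: x + word_pt w).
    exact: IH.
  by rewrite /simil scalerDr scalerA -exprS addrA.
have rho0 : rho != 0 by rewrite invr_eq0 pnatr_eq0 -lt0n.
(* Copies of [U] along different words of equal length are disjoint: the first letters agree by the
   open set condition, and cancelling that similarity allows induction. *)
have D w w' (x y : plane R) : size w = size w' -> U x -> U y ->
    rho ^+ size w *: x + word_pt w = rho ^+ size w *: y + word_pt w' -> w = w'.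
  elim: w w' => [|i w IH] [|j w'] //= [sw] Ux Uy.
  have E (u : seq 'I_s) l (v : plane R) :
      rho ^+ (size u).+1 *: v + (rho *: word_pt u + z l) =
      simil z l (rho ^+ size u *: v + word_pt u).
    by rewrite /simil scalerDr scalerA -exprS addrA.
  rewrite E {2}sw E => e.
  have ij : i = j.
    apply: (tU i j) => //; exists (simil z i (rho ^+ size w *: x + word_pt w)).
    by split; [|rewrite e]; apply: imageP; exact: T.
  rewrite -ij in e *; congr (_ :: _); apply: IH => //.
  move: e; rewrite /simil => /addIr /(scalerI rho0); by rewrite sw.
move: (oU); rewrite openE => /(_ _ Uq).
rewrite /interior => /nbhs_ballP[r /= r0 br].
exists r => // k w w' ww'.
apply/orP; apply: contraT; rewrite negb_or -!ltNge => /andP[d1 d2].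
case/eqP: ww'; apply: val_inj => /=.
have B (c e : R) : `|e| < r * rho ^+ k -> ball c r (c + rho ^- k * e).
  have k0 : 0 < rho ^+ k by rewrite exprn_gt0// invr_gt0 ltr0n.
  move=> er; rewrite /ball/= opprD addNKr normrN normrM normfV (gtr0_norm k0).
  by rewrite ltr_pdivrMl// mulrC.
pose d := word_pt w - word_pt w'.
apply: (D w w' q (q + (rho ^- k *: d))); rewrite ?size_tuple//.
  by apply: br; split; exact: B.
rewrite scalerDr scalerA mulfV ?expf_neq0// scale1r /d.
by rewrite -addrA subrK.
Qed.
End Words.

(** * Linear projections and Favard length *)

Section LinearProjection.
Context {R : realType}.
Implicit Types (theta h c : R) (x y : plane R).
Local Notation mu := (@lebesgue_measure R).

Lemma lin_projD theta x y :
  lin_proj theta (x + y) = lin_proj theta x + lin_proj theta y.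
Proof. rewrite /lin_proj !coordE; ring. Qed.

Lemma lin_projB theta x y :
  lin_proj theta (x - y) = lin_proj theta x - lin_proj theta y.
Proof. rewrite /lin_proj !coordE; ring. Qed.

Lemma lin_projZ theta c x : lin_proj theta (c *: x) = c * lin_proj theta x.
Proof. rewrite /lin_proj !coordE; ring. Qed.

Lemma lin_projDpi theta x : lin_proj (theta + pi) x = - lin_proj theta x.
Proof. rewrite /lin_proj sinD cosD sinpi cospi; ring. Qed.

Lemma continuous_lin_proj x : continuous (fun theta => lin_proj theta x).
Proof.
move=> theta; apply: cvgD; apply: cvgM.
- exact: cvg_cst.
- exact: continuous_cos.
- exact: cvg_cst.
- exact: continuous_sin.
Qed.

(** Chebyshev's inequality; the factor [pi] undoes the normalisation of [Fav]. *)
Lemma Fav_ge (S : set (plane R)) (E : set R) c : 0 <= c -> measurable E ->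
  E `<=` `[0%R, pi] ->
  (forall theta, E theta -> (c%:E <= mu (lin_proj theta @` S))%E) ->
  (c%:E * mu E <= pi%:E * Fav S)%E.
Proof.
move=> c0 mE E0 Ec; rewrite /Fav muleA -EFinM mulfV ?gt_eqF ?pi_gt0// mul1e.
exact: integral_ge_indic.
Qed.

(** The hull contains the segment from [p] to [q]; the point over [t] is found by affine
    interpolation. *)
Lemma lin_proj_convex_hull (J : set (plane R)) theta p q t : J p -> J q ->
  lin_proj theta p <= t <= lin_proj theta q ->
  exists2 x, convex_hull J x & lin_proj theta x = t.
Proof.
set a := lin_proj theta p; set b := lin_proj theta q => Jp Jq /andP[pt tq].
have [ab|ab] := eqVneq a b.
  exists p; first by move=> C [_]; apply.
  by rewrite -/a; lra.
have {}ab : 0 < b - a by rewrite subr_gt0 lt_neqAle ab (le_trans pt).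
pose l := (b - t) / (b - a).
have l0 : 0 <= l by apply: divr_ge0; lra.
have l1 : l <= 1 by rewrite /l ler_pdivrMr//; lra.
exists (l *: p + (1 - l) *: q).
  move=> C [cC JC].
  have := cC p q (Itv01 l0 l1); rewrite !inE conv_planeE/=.
  by apply; exact: JC.
rewrite lin_projD !lin_projZ -/a -/b /l; field; lra.
Qed.

(** * Separated families of projected points *)

Section Packing.
Context {T : finType} (pt : T -> plane R).

Definition separated theta h (Y : {set T}) :=
  forall u v, u \in Y -> v \in Y -> u != v ->
    h <= `|lin_proj theta (pt u) - lin_proj theta (pt v)|.

(* Stands for the set of directions in which a projection has measure at least
   [M * h], but is a finite union of closed sets, hence measurable. *)
Definition rich h M : set R :=
  [set theta | exists Y : {set T}, (M <= #|Y|)%N /\ separated theta h Y].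

Lemma rich_Dpi h M theta : rich h M theta <-> rich h M (theta + pi).
Proof.
have sepE Y : separated (theta + pi) h Y <-> separated theta h Y.
  by split=> sY u v uY vY /(sY u v uY vY); rewrite !lin_projDpi -opprD normrN.
by split=> -[Y [MY sY]]; exists Y; split => //; apply/sepE.
Qed.

Lemma measurable_rich h M : measurable (rich h M).
Proof.
rewrite (_ : rich h M = \bigcup_(Y in [set Y : {set T} | (M <= #|Y|)%N])
    \bigcap_(uv in [set uv : T * T | [/\ uv.1 \in Y, uv.2 \in Y & uv.1 != uv.2]])
    ((fun theta => `|lin_proj theta (pt uv.1) - lin_proj theta (pt uv.2)|)
      @^-1` `[h, +oo[)); last first.
  apply/seteqP; split=> theta.
    move=> [Y [MY sY]]; exists Y => // -[u v] [/= uY vY uv].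
    by rewrite in_itv/= andbT; exact: sY.
  move=> [Y MY sY]; exists Y; split => // u v uY vY uv.
  by have := sY (u, v) (And3 uY vY uv); rewrite /= in_itv/= andbT.
apply: fin_bigcup_measurable; first exact: finite_finset.
move=> Y _; apply: closed_measurable; apply: closed_bigI => -[u v] _.
apply: closed_comp; last exact: interval_closed.
move=> theta _; apply: cvg_norm.
by apply: cvgB; exact: continuous_lin_proj.
Qed.

(** A separated family of maximal cardinality is a net: a point far from all its members could be
    added to it. *)
Lemma not_rich_cover h M theta : 0 < h -> ~ rich h M theta ->
  exists2 Y : {set T}, (#|Y| < M)%N &
    forall u, exists2 v, v \in Y &
      `|lin_proj theta (pt u) - lin_proj theta (pt v)| < h.
Proof.
move=> h0 nr.
pose P (Y : {set T}) := `[< separated theta h Y >].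
have P0 : P finset.set0 by apply/asboolP => u v; rewrite inE.
case: (arg_maxnP (fun Y : {set T} => #|Y|) P0) => Y /asboolP sY maxY.
exists Y; first by rewrite ltnNge; apply/negP => MY; apply: nr; exists Y.
move=> u; apply: contrapT => nu.
have far v : v \in Y -> h <= `|lin_proj theta (pt u) - lin_proj theta (pt v)|.
  by move=> vY; rewrite leNgt; apply/negP => lt; apply: nu; exists v.
have uY : u \notin Y.
  by apply/negP => /far; rewrite subrr normr0 leNgt h0.
have : P (u |: Y)%SET.
  apply/asboolP => v w; rewrite !finset.in_setU1 => /orP[/eqP->|vY] /orP[/eqP->|wY].
  - by rewrite eqxx.
  - by move=> _; exact: far.
  - by move=> _; rewrite distrC; exact: far.
  - exact: sY.
by move=> /maxY; rewrite cardsU1 uY /= add1n ltnn.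
Qed.

(** Half-open intervals of length [h] starting at [h]-separated points are disjoint, so their
    lengths add up. The common offset [b] does not affect this. *)
Lemma rich_measure_ge h M theta (b : R) (A : set R) : 0 < h -> rich h M theta ->
  (forall u t,
    lin_proj theta (pt u) + b <= t < lin_proj theta (pt u) + b + h -> A t) ->
  ((M%:R * h)%:E <= mu A)%E.
Proof.
move=> h0 [Y [MY sY]] bA.
pose F u : set R :=
  `[lin_proj theta (pt u) + b, lin_proj theta (pt u) + b + h[%classic.
have Fh u : mu (F u) = h%:E.
  rewrite /F lebesgue_measure_itv/= lte_fin ltrDl h0.
  by rewrite -EFinB; congr EFin; ring.
have FA : \bigcup_(u in [set` enum Y]) F u `<=` A.
  by move=> t [u _]; rewrite /F/= in_itv/=; exact: bA.
apply: le_trans (le_lebesgue FA).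
rewrite measure_fin_bigcup//.
- rewrite -fsbig_seq ?enum_uniq//.
  rewrite (eq_bigr (fun=> h%:E)); last first.
    by move=> u _; exact: Fh.
  rewrite sumEFin lee_fin big_enum sumr_const -[leRHS]mulr_natl.
  by rewrite ler_wpM2r ?(ltW h0)// ler_nat.
- move=> u v /=; rewrite !mem_enum => uY vY [t []]; rewrite /F/= !in_itv/=.
  move=> /andP[u1 u2] /andP[v1 v2]; apply: contrapT => /eqP uv.
  have := sY _ _ uY vY uv; rewrite leNgt ltr_norml => /negP; apply.
  by apply/andP; split; lra.
- by move=> u _; exact: measurable_itv.
Qed.
End Packing.
End LinearProjection.

(** * Radial projections *)

Section Polar.
Context {R : realType}.
Implicit Types (r t e d kappa : R) (a x y : plane R).

Definition polar a x r t := x.1 - a.1 = r * cos t /\ x.2 - a.2 = r * sin t.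

Definition coord_dist_le d x y := `|x.1 - y.1| <= d /\ `|x.2 - y.2| <= d.

Lemma radial_projP a x t : x <> a -> radial_proj a x = (cos t, sin t) ->
  exists2 r, 0 < r & polar a x r t.
Proof.
move=> xa [c1 c2].
have n0 : 0 < enorm (x - a).
  rewrite sqrtr_gt0 !coordE lt_neqAle addr_ge0 ?sqr_ge0// andbT eq_sym.
  apply/eqP => /eqP; rewrite paddr_eq0 ?sqr_ge0// !sqrf_eq0 !subr_eq0.
  by move=> /andP[/eqP e1 /eqP e2]; apply: xa; exact: planeP.
exists (enorm (x - a)) => //; split.
  by rewrite -c1 mulVKf ?gt_eqF.
by rewrite -c2 mulVKf ?gt_eqF.
Qed.

(** The radius [r] is the inner product of [x - a] with [(cos t, sin t)]; replacing [x] by [x']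
    changes it by at most [2 * e]. *)
Lemma polar_radius_le a x x' r r' t t' e : polar a x r t -> polar a x' r' t' ->
  coord_dist_le e x x' -> r <= r' * cos (t - t') + 2 * e.
Proof.
move=> [x1 x2] [y1 y2] [d1 d2].
have -> : r = cos t * (r * cos t) + sin t * (r * sin t).
  by have := cos2Dsin2 t; rewrite !expr2 => h; rewrite -[LHS]mulr1 -h; ring.
rewrite -x1 -x2 cosB.
have -> : r' * (cos t * cos t' + sin t * sin t') =
    cos t * (r' * cos t') + sin t * (r' * sin t') by ring.
rewrite -y1 -y2.
have bound (u v : R) : `|u| <= 1 -> `|v| <= e -> u * v <= e.
  move=> u1 ve; apply: le_trans (ler_norm _) _; rewrite normrM.
  by rewrite -[leRHS]mul1r ler_pM.
have := bound _ _ (cos_max t) d1; have := bound _ _ (sin_max t) d2; lra.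
Qed.

Lemma polar_radius_ge a x r t d :
  0 < r -> polar a x r t -> d <= `|x.1 - a.1| \/ d <= `|x.2 - a.2| -> d <= r.
Proof.
move=> r0 [-> ->]; rewrite !normrM (gtr0_norm r0).
have c1 := cos_max t; have s1 := sin_max t.
by move=> [|] /le_trans; apply; rewrite -[leRHS]mulr1 ler_wpM2l// ltW.
Qed.

(* The cross product of [x - a] and [x' - a] is that of [x - x'] and [x' - a];
   replacing [x' - a] by [x0 - a] costs a quadratic error and produces the
   projection of [x - x'] orthogonal to the direction of [x0]. *)
Lemma polar_angle_le a x0 x x' r0 r r' t0 t t' d e kappa :
  0 < d -> 8 * e <= d -> d / 2 <= r0 -> d / 2 <= r -> d / 2 <= r' ->
  polar a x0 r0 t0 -> polar a x r t -> polar a x' r' t' ->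
  coord_dist_le e x0 x -> coord_dist_le e x' x0 -> coord_dist_le e x x' ->
  coord_dist_le e x' x ->
  `|lin_proj (t0 + pi / 2) (x - x')| <= kappa ->
  2^-1 <= cos (t - t') /\
  `|sin (t - t')| <= 3 * kappa / d + 8 * e ^+ 2 / d ^+ 2.
Proof.
move=> d0 ed r0d rd r'd p0 p p' d0x dx0 dxx' dx'x.
rewrite /lin_proj sinDpihalf cosDpihalf !coordE => proj.
(* Indeed [r0 <= r + 2 * e], and [2 * e <= d / 4 <= r / 2]. *)
have r0r : r0 <= 3 / 2 * r.
  have := polar_radius_le p0 p d0x; have := cos_le1 (t0 - t) => c1.
  have : r * cos (t0 - t) <= r by rewrite -[leRHS]mulr1 ler_wpM2l//; lra.
  lra.
split.
  (* Adding both radius estimates gives [(r + r') * (1 - cos (t - t')) <= 4 * e], which is at most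
     half of [r + r']. *)
  have h1 := polar_radius_le p p' dxx'; have := polar_radius_le p' p dx'x.
  rewrite -opprB cosN => h2.
  have : (r + r') * (1 - cos (t - t')) <= (r + r') * 2^-1 by lra.
  rewrite ler_pM2l; lra.
have crossE : r * r' * sin (t - t') =
    r0 * ((x.1 - x'.1) * - sin t0 + (x.2 - x'.2) * cos t0) +
    ((x.2 - x'.2) * (x'.1 - x0.1) - (x.1 - x'.1) * (x'.2 - x0.2)).
  have -> : r0 * ((x.1 - x'.1) * - sin t0 + (x.2 - x'.2) * cos t0) =
    (x.2 - x'.2) * (r0 * cos t0) - (x.1 - x'.1) * (r0 * sin t0) by ring.
  rewrite sinB.
  have -> : r * r' * (sin t * cos t' - cos t * sin t') =
    (r * sin t) * (r' * cos t') - (r * cos t) * (r' * sin t') by ring.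
  case: p0 p p' => <- <- [<- <-] [<- <-]; ring.
have bound (u v : R) : `|u| <= e -> `|v| <= e -> `|u * v| <= e ^+ 2.
  by move=> ue ve; rewrite normrM expr2 ler_pM.
have B : r * r' * `|sin (t - t')| <= 3 / 2 * r * kappa + 2 * e ^+ 2.
  have -> : r * r' * `|sin (t - t')| = `|r * r' * sin (t - t')|.
    by rewrite normrM ger0_norm// mulr_ge0//; lra.
  rewrite crossE; apply: le_trans (ler_normD _ _) _; apply: lerD.
    rewrite normrM ger0_norm; last by lra.
    by apply: ler_pM => //; lra.
  apply: le_trans (ler_normB _ _) _.
  have := bound _ _ dxx'.2 dx0.1; have := bound _ _ dxx'.1 dx0.2; lra.
have k0 : 0 <= kappa by apply: le_trans proj.
have rr : d ^+ 2 / 4 <= r * r'.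
  rewrite (_ : _ / 4 = (d / 2) * (d / 2)); last by field.
  by apply: ler_pM => //; lra.
have : `|sin (t - t')| <= (3 / 2 * r * kappa + 2 * e ^+ 2) / (r * r').
  by rewrite ler_pdivlMr ?mulr_gt0//; lra.
(* The linear term is divided using [r' >= d / 2], the quadratic one using
   [r * r' >= d ^+ 2 / 4]. *)
move=> /le_trans; apply; rewrite mulrDl; apply: lerD.
  rewrite (_ : _ / _ = 3 / 2 * kappa / r'); last by field; apply/andP; split; lra.
  rewrite ler_pdivrMr; last by lra.
  rewrite (_ : _ * r' = 3 * kappa / d * r')//.
  apply: le_trans (_ : 3 * kappa / d * (d / 2) <= _).
    by rewrite le_eqVlt; apply/orP; left; apply/eqP; field; lra.
  by rewrite ler_wpM2l// divr_ge0//; lra.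
rewrite ler_pdivrMr; last by rewrite mulr_gt0//; lra.
apply: le_trans (_ : 8 * e ^+ 2 / d ^+ 2 * (d ^+ 2 / 4) <= _).
  by rewrite le_eqVlt; apply/orP; left; apply/eqP; field; lra.
by rewrite ler_wpM2l// divr_ge0// ?sqr_ge0// mulr_ge0// sqr_ge0.
Qed.
End Polar.

(** * Explicit constants *)

Section Constants.
Context {R : realType}.
Implicit Types (c d delta : R).

(** The angle bound of [polar_angle_le] for [kappa = (2 * c + 2 * d) * rho ^+ (m + k)] and
    [e = rho ^+ m * d], with [rho ^+ (m + k)] factored out. *)
Definition arc_const c d delta : R :=
  3 * (2 * c + 2 * d) / delta + 8 * d ^+ 2 / delta ^+ 2.

Lemma arc_const_ge0 c d delta : 0 < c -> 0 <= d -> 0 < delta ->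
  0 <= arc_const c d delta.
Proof.
move=> c0 d0 delta0; have cd : 0 <= 2 * c + 2 * d by lra.
apply: addr_ge0; apply: divr_ge0.
all: by rewrite ?sqr_ge0 ?(ltW delta0) ?mulr_ge0 ?sqr_ge0.
Qed.

(** The first summand pays for the rich directions, the second for the poor ones. *)
Definition vis_const c d delta : R :=
  (2 * pi)^-1 * (3 * pi + 12 * arc_const c d delta / c).

Lemma vis_const_gt0 c d delta : 0 < c -> 0 <= d -> 0 < delta ->
  0 < vis_const c d delta.
Proof.
move=> c0 d0 delta0; have pi0 := pi_gt0 R.
rewrite mulr_gt0// ?invr_gt0 ?mulr_gt0// ltr_pwDl ?mulr_gt0//.
by rewrite divr_ge0 ?mulr_ge0 ?arc_const_ge0// ltW.
Qed.

End Constants.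

(** * Projections of the approximations and of their small pieces *)

Section Approximations.
Context {R : realType} {s : nat} (z : 'I_s -> plane R) (J : set (plane R)).
Hypothesis s0 : (0 < s)%N.
Local Notation rho := ((s%:R : R)^-1).
Local Notation mu := (@lebesgue_measure R).
Local Notation word k := (fun w : k.-tuple 'I_s => word_pt z w).
Implicit Types (c d theta : R) (k m n M : nat).

Let rho_gt0 : 0 < rho. Proof. by rewrite invr_gt0 ltr0n. Qed.
Let rho_le1 : rho <= 1. Proof. by rewrite invf_le1 ?ltr0n// ler1n. Qed.
Let rhoX k : 0 < rho ^+ k. Proof. exact: exprn_gt0. Qed.

(** Two points witnessing that the hull of [J] projects onto an interval of length at least [c]. *)
Definition wide c theta := exists p q : plane R,
  [/\ J p, J q & c <= lin_proj theta q - lin_proj theta p].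

(** The projection of each level [k] cell contains an interval of length [c * rho ^+ k], starting at
    the projected word point plus an offset common to all words. *)
Lemma proj_approx_ge c theta k M : 0 < c -> wide c theta ->
  rich (word k) (c * rho ^+ k) M theta ->
  ((M%:R * (c * rho ^+ k))%:E <= mu (lin_proj theta @` ifs_approx z J k))%E.
Proof.
move=> c0 [p [q [Jp Jq pq]]] hrich.
apply: (rich_measure_ge (b := rho ^+ k * lin_proj theta p) _ hrich).
  by rewrite mulr_gt0.
move=> w t /andP[t1 t2].
have [|y Hy yE] := @lin_proj_convex_hull R J theta p q
    ((t - lin_proj theta (word_pt z w)) / rho ^+ k) Jp Jq.
  rewrite ler_pdivlMr// ler_pdivrMr//; apply/andP; split; first by lra.
  apply: le_trans (_ : (lin_proj theta p + c) * rho ^+ k <= _); first by lra.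
  by rewrite ler_wpM2r ?(ltW (rhoX k))//; lra.
exists (rho ^+ k *: y + word_pt z w).
  by apply/iter_ifs_stepP; exists w, y.
rewrite lin_projD lin_projZ yE mulrC divfK ?gt_eqF//; ring.
Qed.

Lemma rich1 c theta k : rich (word k) c 1 theta.
Proof.
exists [set [tuple of nseq k (Ordinal s0)]]%SET; rewrite cards1; split=> // u v.
by rewrite !finset.in_set1 => /eqP-> /eqP->; rewrite eqxx.
Qed.

(** Serves in two ways: to bound the measure of the rich directions, and, with [E] an interval, to
    bound [Fav] from below. *)
Lemma Fav_rich_ge c k M (E : set R) : 0 < c -> measurable E ->
  E `<=` `[0%R, pi] ->
  (forall theta, E theta -> wide c theta /\ rich (word k) (c * rho ^+ k) M theta) ->
  ((M%:R * (c * rho ^+ k))%:E * mu E <= pi%:E * Fav (ifs_approx z J k))%E.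
Proof.
move=> c0 mE E0 hE; apply: Fav_ge => //.
  by rewrite mulr_ge0// mulr_ge0// ltW.
by move=> theta /hE[wt rt]; exact: proj_approx_ge.
Qed.

Lemma coord_dist_lin_proj theta d (x y : plane R) : coord_dist_le d x y ->
  `|lin_proj theta (x - y)| <= 2 * d.
Proof.
move=> [d1 d2]; rewrite /lin_proj !coordE; apply: le_trans (ler_normD _ _) _.
have bound (u v : R) : `|u| <= 1 -> `|v| <= d -> `|v * u| <= d.
  by move=> u1 vd; rewrite normrM -[leRHS]mulr1 ler_pM.
have := bound _ _ (cos_max theta) d1; have := bound _ _ (sin_max theta) d2; lra.
Qed.

Lemma coord_distZ d r (v x y : plane R) : 0 <= r -> coord_dist_le d x y ->
  coord_dist_le (r * d) (r *: x + v) (r *: y + v).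
Proof.
move=> r0 [d1 d2]; rewrite /coord_dist_le !coordE.
have E (b b' w : R) : r * b + w - (r * b' + w) = r * (b - b') by ring.
by split; rewrite E normrM (ger0_norm r0) ler_wpM2l.
Qed.

Section Piece.
Variables (a : plane R) (c d delta : R) (k m M : nat) (v : plane R).
Hypotheses (c0 : 0 < c) (d0 : 0 <= d) (delta0 : 0 < delta) (km : (k <= m)%N).
Hypothesis Jdiam : forall x y, convex_hull J x -> convex_hull J y ->
  coord_dist_le d x y.
Hypothesis md : 8 * (rho ^+ m * d) <= delta.
Hypothesis far : forall x, convex_hull J x ->
  delta / 2 <= `|(rho ^+ m *: x + v).1 - a.1| \/
  delta / 2 <= `|(rho ^+ m *: x + v).2 - a.2|.
Hypothesis zJ : ifs_step z J `<=` J.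

Let C := arc_const c d delta.

Let C0 : 0 <= C. Proof. exact: arc_const_ge0. Qed.

(* Directions from [a] of the points of the piece [rho ^+ m *: J_k + v] whose
   orthogonal direction is not rich. *)
Definition poor_directions : set R := [set t | 0 <= t < 2 * pi /\
  exists (x : plane R) (r : R), [/\ ifs_approx z J k x, 0 < r,
    polar a (rho ^+ m *: x + v) r t &
    ~ rich (word k) (c * rho ^+ k) M.+1 (t + pi / 2)]].

(** At one poor direction [t0], a net of at most [M] words covers all projected word points. Cells
    near the same net word are seen under almost the same angle, so the poor directions split into
    [M] short arcs. *)
Lemma poor_directions_le :
  (mu poor_directions <= (M%:R * (12 * (C * rho ^+ (m + k))))%:E)%E.
Proof.
have [[t0 [_ [x0 [r0 [Jx0 r0gt0 p0 nr]]]]]|nA] := pselect (poor_directions !=set0);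
    last first.
  apply: (@le_trans _ _ (mu set0)).
    by apply: le_lebesgue => t At; case: nA; exists t.
  by rewrite measure0 lee_fin !mulr_ge0// ltW.
have [|Y YM Ycov] := not_rich_cover _ nr; first by rewrite mulr_gt0.
pose F (w : k.-tuple 'I_s) : set R := [set t | 0 <= t < 2 * pi /\
  exists (u : k.-tuple 'I_s) (y : plane R) (r : R),
  [/\ convex_hull J y, 0 < r,
    polar a (rho ^+ m *: (rho ^+ k *: y + word_pt z u) + v) r t &
    `|lin_proj (t0 + pi / 2) (word_pt z u) -
      lin_proj (t0 + pi / 2) (word_pt z w)| < c * rho ^+ k]].
have hullS : ifs_approx z J k `<=` convex_hull J.
  apply: (@iter_ifs_step_dec _ _ z (convex_hull J) 0) => //.
  exact: convex_hull_ifs_step.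
apply: (@le_trans _ _
  ((size (enum Y))%:R * (12 * (C * rho ^+ (m + k))))%:E); last first.
  rewrite -cardE lee_fin ler_wpM2r ?ler_nat//.
  by rewrite !mulr_ge0// ltW.
apply: (@lebesgue_cover R _ _ F).
  move=> t [t2 [x [r [/iter_ifs_stepP[u [y [Jy ->]]] rgt0 pt _]]]].
  have [w wY uw] := Ycov u.
  exists w; first by rewrite mem_enum.
  by split => //; exists u, y, r.
move=> w _; apply: arc_measure_le; first by rewrite mulr_ge0// ltW.
  by move=> t [].
move=> t t' [_ [u [y [r [Jy rgt0 pt uw]]]]] [_ [u' [y' [r' [Jy' r'gt0 pt' u'w]]]]].
have I (l : k.-tuple 'I_s) q :
    convex_hull J q -> convex_hull J (rho ^+ k *: q + word_pt z l).
  by move=> Jq; apply: hullS; apply/iter_ifs_stepP; exists l, q.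
have Jx := I u y Jy; have Jx' := I u' y' Jy'; have Jx0' := hullS _ Jx0.
have near p q (Jp : convex_hull J p) (Jq : convex_hull J q) := 
  coord_distZ v (ltW (rhoX m)) (Jdiam Jp Jq).
(* The [2 * c] comes from two words near the same net word [w], the [2 * d] from the positions
   inside the two cells. *)
have proj : `|lin_proj (t0 + pi / 2) (rho ^+ m *: (rho ^+ k *: y + word_pt z u) + v
    - (rho ^+ m *: (rho ^+ k *: y' + word_pt z u') + v))| <=
    (2 * c + 2 * d) * rho ^+ (m + k).
  rewrite lin_projB !lin_projD !lin_projZ lin_projD lin_projZ lin_projD lin_projZ.
  have := coord_dist_lin_proj (t0 + pi / 2) (Jdiam Jy Jy').
  rewrite lin_projB.
  move: uw u'w.
  set pu := lin_proj _ (word_pt z u); set pu' := lin_proj _ (word_pt z u').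
  set pw := lin_proj _ (word_pt z w).
  set py := lin_proj _ y; set py' := lin_proj _ y'.
  move=> uw u'w yy.
  have -> : rho ^+ m * (rho ^+ k * py + pu) + lin_proj (t0 + pi / 2) v -
     (rho ^+ m * (rho ^+ k * py' + pu') + lin_proj (t0 + pi / 2) v) =
     rho ^+ m * (rho ^+ k * (py - py') + (pu - pu')) by ring.
  rewrite normrM (gtr0_norm (rhoX m)) exprD [leRHS]mulrCA.
  rewrite ler_wpM2l// ?(ltW (rhoX m))//.
  apply: le_trans (ler_normD _ _) _; rewrite normrM (gtr0_norm (rhoX k)).
  have : `|pu - pu'| <= 2 * c * rho ^+ k.
    by move: uw u'w; rewrite ltr_norml ler_norml ltr_norml => /andP[? ?] /andP[? ?];
      apply/andP; split; lra.
  have : rho ^+ k * `|py - py'| <= rho ^+ k * (2 * d) by rewrite ler_wpM2l// ltW.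
  lra.
have [h1 h2] := polar_angle_le delta0 md (polar_radius_ge r0gt0 p0 (far Jx0'))
  (polar_radius_ge rgt0 pt (far Jx)) (polar_radius_ge r'gt0 pt' (far Jx'))
  p0 pt pt' (near _ _ Jx0' Jx) (near _ _ Jx' Jx0') (near _ _ Jx Jx')
  (near _ _ Jx' Jx) proj.
split=> //; apply: (le_trans h2); rewrite /C /arc_const [leRHS]mulrDl; apply: lerD.
  by rewrite le_eqVlt; apply/orP; left; apply/eqP; ring.
(* Here [k <= m] makes the quadratic error no larger than the cell size [rho ^+ (m + k)]. *)
rewrite [leLHS](_ : _ = 8 * d ^+ 2 / delta ^+ 2 * (rho ^+ m * rho ^+ m));
  last by ring.
rewrite exprD ler_wpM2l//.
  by rewrite divr_ge0 ?sqr_ge0// mulr_ge0// sqr_ge0.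
by rewrite ler_wpM2l ?(ltW (rhoX m))// ler_wiXn2l.
Qed.

End Piece.
End Approximations.

(** * Distances and diameters of compact sets *)

Section Compactness.
Context {R : realType}.
Implicit Types (J K : set (plane R)) (x y a : plane R).

(** The max-norm distance attains its minimum on [K] times [J], and disjointness makes it
    positive. *)
Lemma compact_coord_far J K : compact J -> compact K -> K `&` J = set0 ->
  exists2 delta : R, 0 < delta & forall a y, K a -> J y ->
    delta <= `|y.1 - a.1| \/ delta <= `|y.2 - a.2|.
Proof.
move=> cJ cK KJ0.
have [KJne|KJe] := pselect (K `*` J !=set0); last first.
  by exists 1 => // a y Ka Jy; case: KJe; exists (a, y).
pose f (u : plane R * plane R) := `|u.2 - u.1|.
have cf : {within K `*` J, continuous f}.
  apply: continuous_subspaceT => u; apply: cvg_norm.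
  by apply: cvgB; [exact: cvg_snd|exact: cvg_fst].
have [[a0 y0]] := compact_EVT_min KJne (compact_setX cK cJ) cf.
rewrite inE => -[/= Ka0 Jy0] fmin.
exists (f (a0, y0)).
  rewrite /f/= normr_gt0 subr_eq0; apply/eqP => ya.
  have : (K `&` J) a0 by split=> //; rewrite -ya.
  by rewrite KJ0.
move=> a y Ka Jy; have := fmin (a, y); rewrite inE => /(_ (conj Ka Jy)).
by rewrite {2}/f/= prod_normE le_max => /orP[]; [left|right].
Qed.

(** A square containing [J] is convex, hence contains the hull. *)
Lemma compact_hull_diam J : compact J ->
  exists2 d : R, 0 <= d & forall x y, convex_hull J x -> convex_hull J y ->
    coord_dist_le d x y.
Proof.
move=> /compact_bounded [b [_ hb]].
pose B := `|b| + 1.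
have hJ x : J x -> `|x.1| <= B /\ `|x.2| <= B.
  move=> Jx; have : `|x| <= B.
    by apply: (hb B) => //; rewrite /B (le_lt_trans (ler_norm b))// ltrDl.
  by rewrite prod_normE ge_max => /andP[].
have hull x : convex_hull J x -> `|x.1| <= B /\ `|x.2| <= B.
  move=> Jx; apply: (Jx [set x : plane R | `|x.1| <= B /\ `|x.2| <= B]).
  split=> // u v l; rewrite !inE conv_planeE => -[u1 u2] [v1 v2].
  rewrite /mkset !coordE.
  have l0 : 0 <= l%:num by [].
  have l1 : 0 <= 1 - l%:num by rewrite subr_ge0.
  have cv (e e' : R) : `|e| <= B -> `|e'| <= B ->
      `|l%:num * e + (1 - l%:num) * e'| <= B.
    move=> eB eB'; apply: le_trans (ler_normD _ _) _.
    rewrite !normrM (ger0_norm l0) (ger0_norm l1).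
    have := ler_wpM2l l0 eB; have := ler_wpM2l l1 eB'; lra.
  by split; exact: cv.
exists (2 * B); first by rewrite mulr_ge0// /B addr_ge0.
move=> x y /hull[x1 x2] /hull[y1 y2].
by split; apply: le_trans (ler_normB _ _) _; lra.
Qed.

End Compactness.

Lemma dist_far_near (R : realType) (u v b e delta : R) : 0 < delta ->
  8 * e <= delta -> `|u - v| <= e -> delta <= `|u - b| -> delta / 2 <= `|v - b|.
Proof.
move=> delta0 ed uv ub; have := ler_normD (u - v) (v - b).
by rewrite addrA subrK; lra.
Qed.

(** * Visibility estimate for sets with wide projections *)

Section Visibility.
Context {R : realType} {s : nat} (z : 'I_s -> plane R) (J : set (plane R)).
Hypotheses (s2 : (2 <= s)%N) (hJ : self_similar_set z J).
Local Notation rho := ((s%:R : R)^-1).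
Local Notation mu := (@lebesgue_measure R).
Implicit Types (c d theta : R) (k m n M : nat) (a p q x y : plane R).

Let s0 : (0 < s)%N. Proof. exact: leq_trans s2. Qed.
Let rho_gt0 : 0 < rho. Proof. by rewrite invr_gt0 ltr0n. Qed.
Let rhoX k : 0 < rho ^+ k. Proof. exact: exprn_gt0. Qed.
Let zJ : ifs_step z J `<=` J. Proof. by case: hJ => _ _ <-. Qed.

Lemma word_in_J k (w : k.-tuple 'I_s) p : J p -> J (rho ^+ k *: p + word_pt z w).
Proof.
move=> Jp; apply: (iter_ifs_step_dec (n := k) zJ (leq0n k)).
by apply/iter_ifs_stepP; exists w, p.
Qed.

Lemma vis_le1 a (S : set (plane R)) : (vis a S <= 1)%E.
Proof.
have p2 : 0 < 2 * pi :> R by rewrite mulr_gt0// pi_gt0.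
apply: (@le_trans _ _ (((2 * pi)^-1)%:E * mu `[0%R, (2 * pi)%R])%E).
  rewrite lee_pmul2l// ?lte_fin ?invr_gt0//.
  apply: le_lebesgue => t [/andP[t0 t2] _] /=.
  by rewrite in_itv/= t0 ltW.
by rewrite lebesgue_measure_itv/= lte_fin p2 oppr0 adde0 -EFinM mulVf// gt_eqF.
Qed.

(** Visibility never exceeds [1], so a lower bound on the Favard length suffices. This settles the
    collinear case and the index [0]. *)
Lemma vis_le_of_Fav_ge c a (S S' : set (plane R)) : 0 < c -> (c%:E <= Fav S)%E ->
  (vis a S' <= ((Num.sqrt c)^-1)%:E * sqrte (Fav S))%E.
Proof.
move=> c0 cF; apply: le_trans (vis_le1 a S') _.
have sc : 0 < Num.sqrt c by rewrite sqrtr_gt0.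
apply: (@le_trans _ _ (((Num.sqrt c)^-1)%:E * sqrte c%:E)%E).
  by rewrite /= -EFinM mulVf// gt_eqF.
rewrite lee_pmul2l ?lte_fin ?invr_gt0//.
by rewrite lee_sqrt// (le_trans _ cF)// lee_fin ltW.
Qed.

Lemma rhoX_small (d e : R) : 0 < e -> exists m, rho ^+ m * d <= e.
Proof.
move=> e0; pose m := (Num.truncn (d / e)).+1; exists m.
have : d / e < m%:R by exact: truncnS_gt.
rewrite ltr_pdivrMr// => dm.
rewrite exprVn mulrC ler_pdivrMr ?exprn_gt0 ?ltr0n//.
apply: (le_trans (ltW dm)); rewrite mulrC ler_pM2l//.
by rewrite -natrX ler_nat; apply/ltnW/ltn_expl.
Qed.

(** The approximations decrease, so [J_n] lies in [J_(m+k)], which is a union of pieces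
    [rho ^+ m *: J_k + word_pt z w]. *)
Lemma radial_approx_cover a k m n M c t : (k + m <= n)%N ->
  (radial_proj a @` (ifs_approx z J n `\ a)) (cos t, sin t) -> 0 <= t < 2 * pi ->
  ~ rich (fun w : k.-tuple 'I_s => word_pt z w) (c * rho ^+ k) M.+1 (t + pi / 2) ->
  exists w : m.-tuple 'I_s, poor_directions z J a c k m M (word_pt z w) t.
Proof.
move=> kmn [x [Jx xa] xt] t2 nr.
have [r r0 pr] := radial_projP xa xt.
have : ifs_approx z J (m + k) x.
  apply: (iter_ifs_step_dec (convex_hull_ifs_step zJ) _ Jx).
  by rewrite addnC.
rewrite /ifs_approx iterD => /iter_ifs_stepP[w [y [Jy xE]]].
by exists w; split => //; exists y, r; rewrite -xE.
Qed.

Section Wide.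
Variables (c d delta : R) (m0 : nat) (a : plane R).
Hypotheses (c0 : 0 < c) (d0 : 0 <= d) (delta0 : 0 < delta).
Hypothesis hwide : forall theta, wide J c theta.
Hypothesis Jdiam : forall x y, convex_hull J x -> convex_hull J y ->
  coord_dist_le d x y.
Hypothesis m0d : rho ^+ m0 * (8 * d) <= delta.
Hypothesis a_far : forall y, J y -> delta <= `|y.1 - a.1| \/ delta <= `|y.2 - a.2|.

Let C := arc_const c d delta.

Lemma wide_vis_le k n : (k + (k + m0) <= n)%N ->
  (vis a (ifs_approx z J n) <=
     (vis_const c d delta)%:E * sqrte (Fav (ifs_approx z J k)))%E.
Proof.
move=> kn; have pi0 := pi_gt0 R.
set m := (k + m0)%N in kn *; set h := c * rho ^+ k.
have h0 : 0 < h by rewrite mulr_gt0.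
have C0 : 0 <= C by exact: arc_const_ge0.
have K0 := vis_const_gt0 c0 d0 delta0.
have md : 8 * (rho ^+ m * d) <= delta.
  apply: le_trans m0d; rewrite mulrCA ler_wpM2r ?mulr_ge0//.
  by rewrite ler_wiXn2l ?leq_addl ?(ltW rho_gt0)// invf_le1 ?ltr0n// ler1n.
have far (w : m.-tuple 'I_s) x : convex_hull J x ->
    delta / 2 <= `|(rho ^+ m *: x + word_pt z w).1 - a.1| \/
    delta / 2 <= `|(rho ^+ m *: x + word_pt z w).2 - a.2|.
  move=> Jx; have [[p Jp] _ _] := hJ.
  (* Every piece contains a point of [J], which is [delta]-far from [a]; the piece is too small to
     come closer than [delta / 2]. *)
  have Jp' : convex_hull J p by move=> B [_]; apply.
  have [e1 e2] := coord_distZ (word_pt z w) (ltW (rhoX m)) (Jdiam Jp' Jx).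
  have close u v b := @dist_far_near R u v b _ _ delta0 md.
  have [l|l] := a_far (word_in_J w Jp).
    by left; exact: close e1 l.
  by right; exact: close e2 l.
have F0 : (0 <= Fav (ifs_approx z J k))%E.
  rewrite mule_ge0 ?lee_fin ?invr_ge0 ?(ltW pi0)//.
  by apply: integral_ge0 => theta _; exact: measure_ge0.
case FE : (Fav (ifs_approx z J k)) F0 => [f| |] // f0; last first.
  by rewrite /= gt0_muley ?lte_fin// leey.
rewrite /= in f0 *; rewrite lee_fin in f0.
set sigma := Num.sqrt f.
have sig0 : 0 <= sigma by exact: sqrtr_ge0.
have fE : f = sigma * sigma by rewrite -expr2 sqr_sqrtr.
(* Chosen so that [M * h <= sigma < M.+1 * h]: the upper bound controls the poor directions, the
   lower one the rich directions. *)
pose M := Num.truncn (sigma / h).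
have M_le : M%:R * h <= sigma.
  by rewrite -ler_pdivlMr// truncn_le divr_ge0// ltW.
have M_gt : sigma < M.+1%:R * h by rewrite -ltr_pdivrMr// truncnS_gt.
pose wpt := fun w : k.-tuple 'I_s => word_pt z w.
pose E := rich wpt h M.+1.
have mE : measurable E by exact: measurable_rich.
have mEI : measurable (E `&` `[0%R, pi]) by exact: measurableI.
have E_le : (mu (E `&` `[0%R, pi]) <= (pi * sigma)%:E)%E.
  have : (mu (E `&` `[0%R, pi]) <= mu `[0%R, pi])%E by apply: le_lebesgue => x [].
  (* Containment in [[0, pi]] rules out infinite measure; Chebyshev then gives
     [M.+1 * h * e <= pi * sigma ^+ 2]. *)
  rewrite lebesgue_measure_itv/= lte_fin pi0 oppr0 adde0.
  have := @Fav_rich_ge _ _ z J s0 c k M.+1 _ c0 mEI (@subIsetr _ _ _).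
  rewrite FE => /(_ (fun theta H => conj (hwide theta) H.1)).
  have : (0 <= mu (E `&` `[0%R, pi]))%E by exact: measure_ge0.
  case: (mu _) => [e| |] //; rewrite -!EFinM !lee_fin -/h => e0 eF _.
  rewrite leNgt; apply/negP => lt.
  have : M.+1%:R * h * e <= pi * sigma * sigma by rewrite -[leRHS]mulrA -fE.
  apply/negP; rewrite -ltNge.
  apply: le_lt_trans (_ : pi * sigma * (M.+1%:R * h) < _).
    by rewrite ler_wpM2l ?mulr_ge0 ?(ltW pi0)// ltW.
  by rewrite [ltRHS]mulrC ltr_pM2r// mulr_gt0.
(* [good] collects the angles orthogonal to rich directions, [bad w] the remaining angles at which
   the piece of [w] is seen. *)
pose bad w := poor_directions z J a c k m M (word_pt z w).
pose good := [set t : R | 0 <= t < 2 * pi /\ E (t + pi / 2)].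
pose badU := \bigcup_(w : m.-tuple 'I_s) bad w.
have good_le : (mu good <= (3 * (pi * sigma))%:E)%E.
  by apply: perp_measure_le => // x; exact: rich_Dpi.
have badU_le : (mu badU <= (12 * C / c * sigma)%:E)%E.
  apply: (@le_trans _ _ ((size (enum {: m.-tuple 'I_s}))%:R *
      (M%:R * (12 * (C * rho ^+ (m + k)))))%:E).
    apply: (@lebesgue_cover R (m.-tuple 'I_s) (enum {: m.-tuple 'I_s}) bad
      (M%:R * (12 * (C * rho ^+ (m + k)))) badU).
      by move=> t [w _ bt]; exists w => //; rewrite mem_enum.
    move=> w _; apply: poor_directions_le => //.
    - exact: leq_addr.
    - exact: far.
  (* The number [s ^ m] of pieces cancels [rho ^+ m], leaving a multiple of [M * h]. *)
  rewrite -cardE card_tuple card_ord lee_fin natrX exprD.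
  have -> : s%:R ^+ m * (M%:R * (12 * (C * (rho ^+ m * rho ^+ k)))) =
      12 * C / c * (M%:R * h) * (s%:R ^+ m * rho ^+ m).
    by rewrite /h; field; rewrite gt_eqF.
  rewrite -exprMn mulfV ?pnatr_eq0 -?lt0n// expr1n mulr1.
  by rewrite ler_wpM2l// divr_ge0 ?mulr_ge0// ltW.
rewrite /vis; apply: (@le_trans _ _ (((2 * pi)^-1)%:E * (mu good + mu badU))%E).
  rewrite lee_pmul2l ?lte_fin ?invr_gt0 ?mulr_gt0//.
  apply: (@le_trans _ _ (mu (good `|` badU))); last first.
    rewrite /lebesgue_measure /lebesgue_stieltjes_measure /measure_extension.
    exact: outer_measureU2.
  apply: le_lebesgue => t [t2 At].
  have [Et|nEt] := pselect (E (t + pi / 2)); first by left.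
  right; have [w ?] := radial_approx_cover kn At t2 nEt.
  by exists w.
rewrite -EFinM /vis_const -/C -[X in (_ <= X%:E)%E]mulrA EFinM.
rewrite lee_pmul2l ?lte_fin ?invr_gt0 ?mulr_gt0//.
apply: le_trans (leeD good_le badU_le) _.
by rewrite -EFinD lee_fin; lra.
Qed.

End Wide.
End Visibility.

(** * Sets contained in a line *)

Definition cross (R : realType) (x y : plane R) : R := x.1 * y.2 - x.2 * y.1.

Section Dichotomy.
Context {R : realType} {s : nat} (z : 'I_s -> plane R) (J : set (plane R)).
Hypotheses (s2 : (2 <= s)%N) (hJ : self_similar_set z J).
Local Notation rho := ((s%:R : R)^-1).
Local Notation mu := (@lebesgue_measure R).
Implicit Types (c d theta : R) (k m n M : nat) (a p q x y : plane R).

(** By Cramer's rule [D * cos theta] and [D * sin theta] are combinations of the projections of [u]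
    and [v]. Were both projections below [c], then [|D|] would be at most [N * c = |D| / 2]. *)
Lemma noncollinear_wide p q r : J p -> J q -> J r ->
  cross (q - p) (r - p) != 0 -> exists2 c, 0 < c & forall theta, wide J c theta.
Proof.
move=> Jp Jq Jr; set u := q - p; set v := r - p; set D := cross u v => D0.
pose N : R := `|u.1| + `|u.2| + `|v.1| + `|v.2| + 1.
have N0 : 0 < N by rewrite ltr_wpDl ?addr_ge0.
have aD : 0 < `|D| by rewrite normr_gt0.
pose c := `|D| / (2 * N); have c0 : 0 < c by rewrite divr_gt0 ?mulr_gt0.
exists c => // theta.
suff [h|h] : c <= `|lin_proj theta q - lin_proj theta p| \/
    c <= `|lin_proj theta r - lin_proj theta p|.
- move: h; rewrite ler_normr => /orP[h|h]; first by exists p, q.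
  by exists q, p; split=> //; rewrite -opprB.
- move: h; rewrite ler_normr => /orP[h|h]; first by exists p, r.
  by exists r, p; split=> //; rewrite -opprB.
rewrite -!lin_projB -/u -/v; apply/orP; apply: contraT.
rewrite negb_or -!ltNge => /andP[pu pv].
have cosE : D * cos theta = v.2 * lin_proj theta u - u.2 * lin_proj theta v.
  by rewrite /D /cross /lin_proj; ring.
have sinE : D * sin theta = u.1 * lin_proj theta v - v.1 * lin_proj theta u.
  by rewrite /D /cross /lin_proj; ring.
have bound (b b' e e' : R) : `|e| < c -> `|e'| < c ->
    `|b * e - b' * e'| <= (`|b| + `|b'|) * c.
  move=> ec ec'; apply: le_trans (ler_normB _ _) _; rewrite !normrM mulrDl.
  by apply: lerD; rewrite ler_wpM2l// ltW.
have h1 : `|D| * `|cos theta| <= (`|v.2| + `|u.2|) * c.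
  by rewrite -normrM cosE; exact: bound.
have h2 : `|D| * `|sin theta| <= (`|u.1| + `|v.1|) * c.
  by rewrite -normrM sinE; exact: bound.
have cs : 1 <= `|cos theta| + `|sin theta|.
  rewrite -(cos2Dsin2 theta) -[cos theta ^+ 2]real_normK ?num_real//.
  rewrite -[sin theta ^+ 2]real_normK ?num_real// !expr2.
  have := cos_max theta; have := sin_max theta => s1 c1.
  by apply: lerD; rewrite -[leRHS]mulr1 ler_wpM2l.
have : `|D| * 1 <= `|D| * (`|cos theta| + `|sin theta|) by rewrite ler_wpM2l.
rewrite mulr1 mulrDr => h3.
have h4 : N * c = `|D| / 2 by rewrite /c; field; rewrite gt_eqF.
have : (`|v.2| + `|u.2|) * c + (`|u.1| + `|v.1|) * c <= N * c.
  by rewrite -mulrDl ler_wpM2r ?(ltW c0)// /N; lra.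
by rewrite h4; lra.
Qed.

Lemma wide_near theta0 (u : plane R) : 0 <= theta0 <= pi / 2 ->
  lin_proj theta0 u != 0 ->
  exists e eta : R, [/\ 0 < e, 0 < eta & `[theta0, theta0 + e] `<=` `[0%R, pi] /\
    forall theta, theta \in `[theta0, theta0 + e] -> eta <= `|lin_proj theta u|].
Proof.
move=> /andP[t0 t1] u0.
pose eta := `|lin_proj theta0 u| / 2.
have eta0 : 0 < eta by rewrite divr_gt0// normr_gt0.
have cu : `|lin_proj theta u| @[theta --> theta0] --> `|lin_proj theta0 u|.
  by apply: cvg_norm; exact: continuous_lin_proj.
have lt : eta < `|lin_proj theta0 u| by rewrite /eta; move: eta0; rewrite /eta; lra.
have : nbhs theta0 [set theta | eta < `|lin_proj theta u|] by exact: cvgr_gt cu _ lt.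
move=> /nbhs_ballP[r /= r0 hr].
(* The cap at [1] keeps the interval below [pi], since [theta0 <= pi / 2] and [pi >= 2]. *)
pose e := Num.min (r / 2) 1.
have e0 : 0 < e by rewrite lt_min; apply/andP; split; lra.
have er : e <= r / 2 by rewrite ge_min lexx.
have e1 : e <= 1 by rewrite ge_min lexx orbT.
exists e, eta; split=> //; split.
  move=> theta /=; rewrite !in_itv/= => /andP[h1 h2].
  by have := pi_ge2 R; move=> p2; apply/andP; split; lra.
move=> theta; rewrite in_itv/= => /andP[h1 h2]; apply: ltW; apply: hr.
by rewrite /ball/= ltr_norml; apply/andP; split; lra.
Qed.

(* On a line, separation of the translates given by the open set condition is
   one-dimensional, so the projections of the approximations do not shrink. *)
Lemma collinear_Fav_ge : open_set_condition z ->
  (forall p q r, J p -> J q -> J r -> cross (q - p) (r - p) = 0) ->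
  exists2 c : R, 0 < c & forall k, (c%:E <= Fav (ifs_approx z J k))%E.
Proof.
move=> osc col.
have s0 : (0 < s)%N by exact: leq_trans s2.
have [r r0 sep] := osc_word_sep osc s0.
have [[P JP] _ _] := hJ.
pose i0 := [tuple Ordinal s0]; pose i1 := [tuple Ordinal s2].
have i01 : i0 != i1 by [].
(* A nonzero difference of two points of [J], hence a direction vector of the line. *)
pose u := (rho ^+ 1 *: P + word_pt z i0) - (rho ^+ 1 *: P + word_pt z i1).
have rho0 : 0 < rho by rewrite invr_gt0 ltr0n.
have uE : u = word_pt z i0 - word_pt z i1 by rewrite /u opprD addrACA subrr add0r.
have usep : 0 < `|u.1| \/ 0 < `|u.2|.
  have r1 : 0 < r * rho ^+ 1 by rewrite mulr_gt0// exprn_gt0.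
  by rewrite uE; case: (sep _ _ _ i01) => h; [left|right]; exact: lt_le_trans h.
have [theta0 theta0I theta0u] : exists2 t, 0 <= t <= pi / 2 & lin_proj t u != 0.
  have pi0 := pi_gt0 R.
  case: usep => h; [exists 0|exists (pi / 2)].
  - by rewrite lexx divr_ge0// ltW.
  - by rewrite /lin_proj cos0 sin0 mulr1 mulr0 addr0 -normr_gt0.
  - by rewrite lexx divr_ge0// ltW.
  - by rewrite /lin_proj cos_pihalf sin_pihalf mulr1 mulr0 add0r -normr_gt0.
have [e [eta [e0 eta0 [E0 Eeta]]]] := wide_near theta0I theta0u.
pose U := `|u.1| + `|u.2|.
have U0 : 0 < U.
  by case: usep => h; [rewrite ltr_pwDl|rewrite ltr_wpDl].
(* The first entry ensures width, the second separation of all [s ^ k] word points. *)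
pose c := Num.min eta (r * eta / U).
have c0 : 0 < c by rewrite lt_min eta0 divr_gt0// mulr_gt0.
exists (c * e / pi).
  by rewrite divr_gt0 ?pi_gt0// mulr_gt0.
move=> k.
pose E := `[theta0, theta0 + e]%classic.
have hE theta : E theta -> wide J c theta /\
    rich (fun w : k.-tuple 'I_s => word_pt z w) (c * rho ^+ k) (s ^ k) theta.
  move=> Et; have ut := Eeta theta Et.
  have J0 := word_in_J hJ i0 JP; have J1 := word_in_J hJ i1 JP.
  split.
    have : c <= `|lin_proj theta u| by rewrite (le_trans _ ut)// ge_min lexx.
    rewrite /u lin_projB ler_normr => /orP[h|h].
      by exists (rho ^+ 1 *: P + word_pt z i1), (rho ^+ 1 *: P + word_pt z i0).
    exists (rho ^+ 1 *: P + word_pt z i0), (rho ^+ 1 *: P + word_pt z i1).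
    by split=> //; rewrite -opprB.
  exists [set: k.-tuple 'I_s]%SET; rewrite cardsT card_tuple card_ord; split=> //.
  move=> w w' _ _ ww'; rewrite -lin_projB.
  set v := word_pt z w - word_pt z w'.
  (* Also [v] is a difference of two points of [J], so it is parallel to [u]. *)
  have uv : cross u v = 0.
    have := col _ _ _ J1 J0 (word_in_J hJ w JP).
    have := col _ _ _ J1 J0 (word_in_J hJ w' JP).
    rewrite -/u.
    set Q := rho ^+ 1 *: P + _; set A := rho ^+ k *: P.
    rewrite /cross /v !coordE => h1 h2.
    rewrite -[RHS](subrr 0) -{1}h2 -h1; ring.
  have e1 : lin_proj theta v * u.1 = v.1 * lin_proj theta u.
    rewrite /lin_proj; move: uv; rewrite /cross => uv.
    rewrite -[LHS]addr0 -(mulr0 (- sin theta)) -uv; ring.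
  have e2 : lin_proj theta v * u.2 = v.2 * lin_proj theta u.
    rewrite /lin_proj; move: uv; rewrite /cross => uv.
    rewrite -[LHS]addr0 -(mulr0 (cos theta)) -uv; ring.
  (* Parallel vectors have projections proportional to their coordinates, so planar separation
     passes to the projection. *)
  have key : r * rho ^+ k * eta <= `|lin_proj theta v| * U.
    have rk : 0 <= r * rho ^+ k by rewrite mulr_ge0 ?exprn_ge0// ltW.
    case: (sep k w w' ww') => h.
      apply: (@le_trans _ _ (`|lin_proj theta v| * `|u.1|)).
        by rewrite -normrM e1 normrM ler_pM// ltW.
      by rewrite ler_wpM2l// lerDl.
    apply: (@le_trans _ _ (`|lin_proj theta v| * `|u.2|)).
      by rewrite -normrM e2 normrM ler_pM// ltW.
    by rewrite ler_wpM2l// lerDr.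
  apply: (@le_trans _ _ (r * eta / U * rho ^+ k)).
    by rewrite ler_wpM2r ?exprn_ge0 ?(ltW rho0)// ge_min lexx orbT.
  by rewrite mulrAC ler_pdivrMr// [r * eta * _]mulrAC.
have := Fav_rich_ge s0 c0 (measurable_itv _) E0 hE.
rewrite lebesgue_measure_itv/= lte_fin ltrDl e0 -EFinB -EFinM.
rewrite (_ : (s ^ k)%:R * (c * rho ^+ k) * (theta0 + e - theta0) = c * e);
  last first.
  rewrite natrX mulrCA -exprMn mulfV ?pnatr_eq0 -?lt0n// expr1n; ring.
case: (Fav _) => [f| |] //=.
- rewrite -EFinM !lee_fin => h; rewrite ler_pdivrMr ?pi_gt0//; lra.
- by move=> _; rewrite leey.
- by rewrite gt0_muleNy ?lte_fin ?pi_gt0// leeNy_eq.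
Qed.
End Dichotomy.

(** * Uniform bound over compact sets of viewpoints *)

Lemma uniform_visibility_bound (R : realType) (s : nat) (z : 'I_s -> plane R)
    (J K : set (plane R)) : (2 <= s)%N -> self_similar_set z J ->
  open_set_condition z -> compact K -> K `&` J = set0 ->
  exists C1 C2 : R, [/\ 0 < C1, 0 < C2 & forall a n, K a -> (1 <= n)%N ->
    (vis a (ifs_approx z J n) <=
       C1%:E * sqrte (Fav (ifs_approx z J (Num.truncn (C2 * ln n%:R)))))%E].
Proof.
move=> s2 hJ osc cK KJ0.
have s0 : (0 < s)%N by exact: leq_trans s2.
have [_ cJ _] := hJ.
have [[p [q [r [Jp Jq Jr]]]] cr|col] := pselect (exists p q r : plane R,
    [/\ J p, J q, J r & cross (q - p) (r - p) != 0]); last first.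
  have [p q r Jp Jq Jr|c c0 cF] := collinear_Fav_ge s2 hJ osc.
    by apply/eqP; apply: contrapT => /negP cr; apply: col; exists p, q, r.
  (* The Favard bound holds at every index, so [C2 = 1] is an arbitrary choice. *)
  exists (Num.sqrt c)^-1, 1; split=> //; first by rewrite invr_gt0 sqrtr_gt0.
  by move=> a n _ _; exact: vis_le_of_Fav_ge.
have [c c0 hwide] := noncollinear_wide Jp Jq Jr cr.
have [d d0 Jdiam] := compact_hull_diam cJ.
have [delta delta0 far] := compact_coord_far cJ cK KJ0.
have [m0 m0d] := rhoX_small s2 (8 * d) delta0.
have pi0 := pi_gt0 R.
pose C1 := vis_const c d delta.
have C10 : 0 < C1 by exact: vis_const_gt0.
have sc0 : 0 < (Num.sqrt c)^-1 by rewrite invr_gt0 sqrtr_gt0.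
have m2 : 0 < (m0 + 2)%:R :> R by rewrite ltr0n addn2.
(* The sum covers both the index [0] and positive indices; [C2] is chosen so that
   [k * (m0 + 2) <= ln n]. *)
exists (C1 + (Num.sqrt c)^-1), (m0 + 2)%:R^-1.
split; [exact: addr_gt0|by rewrite invr_gt0|move=> a n Ka n1].
set k := Num.truncn _.
have enlarge b : 0 < b -> b <= C1 + (Num.sqrt c)^-1 ->
    (vis a (ifs_approx z J n) <= b%:E * sqrte (Fav (ifs_approx z J k)))%E ->
    (vis a (ifs_approx z J n) <=
      (C1 + (Num.sqrt c)^-1)%:E * sqrte (Fav (ifs_approx z J k)))%E.
  move=> b0 bC /le_trans; apply; apply: lee_wpmul2r => //.
  exact: sqrte_ge0.
(* At index [0] the number [n] may be smaller than [m0], but every projection of the hull has length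
   at least [c], so [Fav] is at least [c]. *)
have [k0|kn0] := eqVneq k 0%N.
  apply: (enlarge (Num.sqrt c)^-1) => //; first by rewrite lerDr ltW.
  apply: vis_le_of_Fav_ge => //; rewrite k0.
  have := Fav_rich_ge (k := 0%N) s0 c0 (measurable_itv `[0%R, pi]) (@subset_refl _ _)
    (fun theta _ => conj (hwide theta) (rich1 z s0 _ _ _)).
  rewrite lebesgue_measure_itv/= lte_fin pi0 oppr0 adde0 expr0 mulr1 mul1r -EFinM.
  by rewrite mulrC EFinM lee_pmul2l ?lte_fin.
apply: (enlarge C1) => //; first by rewrite lerDl ltW.
apply: (wide_vis_le s2 hJ c0 d0 delta0 hwide Jdiam m0d).
  by move=> y; exact: far.
have ln0 : 0 <= ln n%:R :> R by rewrite ln_ge0// ler1n.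
have : k%:R <= (m0 + 2)%:R^-1 * ln n%:R :> R.
  by rewrite truncn_le mulr_ge0// invr_ge0 ltW.
rewrite mulrC ler_pdivlMr// -natrM => kln.
have : (k * (m0 + 2))%:R <= n%:R :> R.
  by apply: (le_trans kln); rewrite ltW// ln_sublinear// ltr0n.
rewrite ler_nat => kn; apply: leq_trans kn.
(* For [k >= 1], [2 * k + m0 <= k * (m0 + 2)]. *)
by rewrite -lt0n in kn0; nia.
Qed.

Theorem theorem1p3 (R : realType) (s : nat) (hs : (2 <= s)%N)
  (z : 'I_s -> plane R) (J : set (plane R))
  (hJ : self_similar_set z J) (hO : open_set_condition z) :
  (forall a : plane R, ~ J a ->
     exists C1 C2 : R, [/\ 0 < C1, 0 < C2 &
       forall n : nat, (1 <= n)%N ->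
         (vis a (ifs_approx z J n) <=
            C1%:E * sqrte (Fav (ifs_approx z J (Num.truncn (C2 * ln n%:R)))))%E])
  /\
  (forall K : set (plane R), compact K -> K `&` J = set0 ->
     exists C1 C2 : R, [/\ 0 < C1, 0 < C2 &
       forall (a : plane R) (n : nat), K a -> (1 <= n)%N ->
         (vis a (ifs_approx z J n) <=
            C1%:E * sqrte (Fav (ifs_approx z J (Num.truncn (C2 * ln n%:R)))))%E]).
Proof.
have unif := uniform_visibility_bound hs hJ hO.
split; last by move=> K cK KJ; exact: unif.
move=> a nJa; have [|C1 [C2 [C10 C20 h]]] := unif [set a] (@compact_set1 _ _).
  by apply/seteqP; split => // x [-> /nJa].
by exists C1, C2; split => // n; exact: h.
Qed.
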